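(* Let $P$ be a DPAG that contains a DMG $G$. For two nodes $i\neq j$ in $P$, if $i\leftarrow\!\!*\,j$ in $P$, or $i$ and $j$ are not adjacent in $P$, then $i\to j$ is not present in $G$.
   Context: DMGs. A directed mixed graph (DMG) $G=\langle V,E,F\rangle$ has a finite node set $V$, directed edges $i\to j$ and bidirected edges $i\leftrightarrow j$ between distinct nodes; several edges between two nodes are allowed (at most one of each of $i\to j$, $i\leftarrow j$, $i\leftrightarrow j$). A path is an alternating sequence of nodes and edges, each edge connecting consecutive nodes, containing each node at most once. $\mathrm{an}_G(j)$ is the set of nodes $i$ with a (possibly trivial) directed path $i\to\dots\to j$; $\mathrm{de}_G(i)=\{j:i\in\mathrm{an}_G(j)\}$; the strongly connected component of $i$ is $\mathrm{an}_G(i)\cap\mathrm{de}_G(i)$; $\mathrm{an}_G(I)=\bigcup_{i\in I}\mathrm{an}_G(i)$. A non-endpoint node on a path is a collider if both adjacent path edges have an arrowhead at it; other nodes on it are non-colliders. An inducing path between $i$ and $j$ in a DMG $G$ is a path between them on which every collider is in $\mathrm{an}_G(\{i,j\})$ and each non-endpoint non-collider only has outgoing directed edges (on the path) to neighbouring nodes on the path in the same strongly connected component of $G$. DPAGs. A directed partial ancestral graph (DPAG) is a mixed graph with edges of types $\to,\leftarrow,\leftrightarrow,\circ\!\!\to,\leftarrow\!\!\circ,\circ\!\!-\!\!\circ$, at most one edge between two distinct nodes, no self-cycles, no directed cycle and no almost directed cycle (directed path from $i$ to $j$ together with $j\leftrightarrow i$), and no inducing path between non-adjacent nodes (a path all of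 whose non-endpoint nodes are colliders on it and ancestors, via directed paths, of an endpoint). $*$ stands for any edge mark, so $i\leftarrow\!\!*\,j$ means $i\leftarrow j$, $i\leftarrow\!\!\circ j$ or $i\leftrightarrow j$. A DPAG $P$ contains a DMG $G$ with the same node set if: (1) $i,j$ are adjacent in $P$ iff there is an inducing path between them in $G$; (2) $i\,*\!\!\to j$ in $P$ implies $j\notin\mathrm{an}_G(i)$; (3) $i\to j$ in $P$ implies $i\in\mathrm{an}_G(j)$. *)

(* Defs.v *)
From HB Require Import structures.
From mathcomp Require Import all_boot.

Set Implicit Arguments.
Unset Strict Implicit.
Unset Printing Implicit Defensive.

Inductive mark : Type := Tail | Arrow | Circle.

Definition mark_code (m : mark) : option bool :=
  match m with Tail => Some false | Arrow => Some true | Circle => None end.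

Definition mark_decode (o : option bool) : mark :=
  match o with Some false => Tail | Some true => Arrow | None => Circle end.

Lemma mark_codeK : cancel mark_code mark_decode.
Proof. by case. Qed.

HB.instance Definition _ := Equality.copy mark (can_type mark_codeK).

(* [E u a b v]: there is an edge between u and v carrying mark a at u and mark
   b at v, e.g. [E u Tail Arrow v] for u -> v and [E u Arrow Arrow v] for
   u <-> v. *)
Definition mixed_edges (V : finType) : Type := V -> mark -> mark -> V -> bool.

(* The edge of a path used to reach [node] from the preceding node, with its
   mark at the preceding node ([mark_src]) and at [node] ([mark_tgt]). *)
Record step (V : finType) : Type :=
  Step { mark_src : mark; mark_tgt : mark; node : V }.

Section MixedPaths.
Variables (V : finType) (E : mixed_edges V).
Implicit Types (i j u v : V) (p : seq (step V)) (s t : step V).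

Fixpoint walk u p : bool :=
  if p is s :: p' then
    E u (mark_src s) (mark_tgt s) (node s) && walk (node s) p'
  else true.

Definition nodes i p : seq V := i :: map (@node V) p.

Definition is_path i p j : bool :=
  [&& walk i p, uniq (nodes i p) & last i (map (@node V) p) == j].

(* For consecutive steps s, t on a path: the node between them is a collider. *)
Definition collider s t : bool := (mark_tgt s == Arrow) && (mark_src t == Arrow).

(* [Q u s t] holds at every non-endpoint node of the path p from i, where s and
   t are the steps entering and leaving that node and u is the node before s. *)
Definition at_inner_nodes i p (Q : V -> step V -> step V -> Prop) : Prop :=
  forall p1 s t p2,
    p = p1 ++ s :: t :: p2 -> Q (last i (map (@node V) p1)) s t.

End MixedPaths.

Record dmg (V : finType) : Type := Dmg {
  dir : rel V;
  bidir : rel V;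
  dir_irr : irreflexive dir;
  bidir_irr : irreflexive bidir;
  bidir_sym : symmetric bidir
}.

Section DMG.
Variables (V : finType) (G : dmg V).
Implicit Types (i j u v : V) (I : {set V}).

Definition dmg_edges : mixed_edges V := fun u a b v =>
  match a, b with
  | Tail, Arrow => dir G u v
  | Arrow, Tail => dir G v u
  | Arrow, Arrow => bidir G u v
  | _, _ => false
  end.

Definition an j : {set V} := [set i | connect (dir G) i j].
Definition de i : {set V} := [set j | i \in an j].
Definition sc i : {set V} := an i :&: de i.
Definition an_set I : {set V} := \bigcup_(i in I) an i.

Definition dmg_inducing_path i p j : Prop :=
  is_path dmg_edges i p j /\
  at_inner_nodes i p (fun u s t =>
    (collider s t -> node s \in an_set [set i; j]) /\
    (~~ collider s t ->
      (mark_tgt s = Tail -> mark_src s = Arrow -> u \in sc (node s)) /\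
      (mark_src t = Tail -> mark_tgt t = Arrow -> node t \in sc (node s)))).

End DMG.

Definition dpag_marks : seq (mark * mark) :=
  [:: (Tail, Arrow); (Arrow, Tail); (Arrow, Arrow);
      (Circle, Arrow); (Arrow, Circle); (Circle, Circle)].

Section PAGEdges.
Variables (V : finType) (e : V -> V -> option (mark * mark)).
Implicit Types (i j : V).

(* [e i j = Some (a, b)]: the edge between i and j has mark a at i, b at j. *)
Definition pag_edges : mixed_edges V := fun u a b v => e u v == Some (a, b).
Definition pag_adj : rel V := fun i j => e i j != None.
Definition pag_dir : rel V := fun i j => e i j == Some (Tail, Arrow).
Definition pag_bidir : rel V := fun i j => e i j == Some (Arrow, Arrow).

Definition pag_inducing_path i p j : Prop :=
  is_path pag_edges i p j /\
  at_inner_nodes i p (fun _ s t =>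
    collider s t /\
    (connect pag_dir (node s) i \/ connect pag_dir (node s) j)).

End PAGEdges.

Record dpag (V : finType) : Type := Dpag {
  edge : V -> V -> option (mark * mark);
  edge_sym : forall i j, edge j i = omap (fun ab => (ab.2, ab.1)) (edge i j);
  edge_marks : forall i j ab, edge i j = Some ab -> ab \in dpag_marks;
  edge_irr : forall i, edge i i = None;
  edge_acyclic : forall i j,
    connect (pag_dir edge) i j -> ~~ pag_dir edge j i;
  edge_almost_acyclic : forall i j,
    connect (pag_dir edge) i j -> ~~ pag_bidir edge j i;
  edge_maximal : forall i j, i != j -> ~~ pag_adj edge i j ->
    ~ exists p, pag_inducing_path edge i p j
}.

Section Containment.
Variables (V : finType) (P : dpag V) (G : dmg V).
Implicit Types (i j : V).

Definition adjacent i j : bool := pag_adj (edge P) i j.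

(* i *-> j *)
Definition arrow_into i j : Prop := exists a : mark, edge P i j = Some (a, Arrow).

(* i <-* j *)
Definition arrow_from i j : Prop := exists a : mark, edge P i j = Some (Arrow, a).

Record contains : Prop := Contains {
  contains_adj : forall i j, i != j ->
    (adjacent i j <-> exists p, dmg_inducing_path G i p j);
  contains_arrow : forall i j, arrow_into i j -> j \notin an G i;
  contains_dir : forall i j, pag_dir (edge P) i j -> i \in an G j
}.

End Containment.

(* Main.v *)
Require Import Defs.
From mathcomp Require Import all_boot.

(** An edge i -> j of G has two consequences, one against each hypothesis.
    Taken alone it is an inducing path, so i and j are adjacent in P; and it
    makes i an ancestor of j in G, so the edge between i and j in P has no
    arrowhead at i. *)

(** A one-edge path has no inner node at which the conditions could fail. *)
Lemma dir_inducing_path (V : finType) (G : dmg V) (i j : V) :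
  dir G i j -> dmg_inducing_path G i [:: Step Tail Arrow j] j.
Proof.
move=> dij; split; last by case=> [|s' [|t' p1]].
have nij : i != j by apply: contraTneq dij => ->; rewrite dir_irr.
by rewrite /is_path /= dij inE nij eqxx.
Qed.

Theorem proposition7 (V : finType) (P : dpag V) (G : dmg V)
    (hPG : contains P G) (i j : V) (hij : i != j)
    (h : arrow_from P i j \/ ~~ adjacent P i j) :
  ~~ dir G i j.
Proof.
apply/negP => dij; case: h => [[a eij]|/negP[]].
- have into_ji : arrow_into P j i by exists a; rewrite edge_sym eij.
  by move: (contains_arrow hPG into_ji); rewrite inE connect1.
- apply/(contains_adj hPG hij).
  by exists [:: Step Tail Arrow j]; exact: dir_inducing_path.
Qed.
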